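(* Let $R\in\mathbb N$, let $I=\{n\in\mathbb Z : 1\leqslant n\leqslant R\}$, let $a_n\in\mathbb C$ for $n\in I$, and let $\lambda_n\in\mathbb R$ ($n\in I$) satisfy $$|\lambda_n-\lambda_m|\geqslant \gamma>\sqrt{\tfrac{1}{3}+\tfrac{\pi^2}{12}}\quad\text{for all } n,m\in I \text{ with } n\neq m.$$ Define $f(t)=\sum_{n\in I}a_n\operatorname{sinc}(t-\lambda_n)$ for $t\in\mathbb R$. Then $$E_f\geqslant \left(1-\gamma^{-1}\sqrt{\tfrac{1}{3}+\tfrac{\pi^2}{12}}\right)\sum_{n\in I}|a_n|^2.$$
   Context: The sinc function is $\operatorname{sinc}(\alpha)=\frac{\sin(\pi\alpha)}{\pi\alpha}$ for $\alpha\neq 0$ and $\operatorname{sinc}(0)=1$. The energy of a signal $f:\mathbb R\to\mathbb C$ is $E_f=\int_{-\infty}^{\infty}|f(t)|^2\,dt$. *)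

(* Defs.v *)
From mathcomp Require Import all_boot all_order all_algebra.
From mathcomp Require Import all_classical all_reals all_analysis.
From mathcomp Require Export complex.
Set Implicit Arguments. Unset Strict Implicit. Unset Printing Implicit Defensive.
Import Order.TTheory GRing.Theory Num.Theory.
Local Open Scope ring_scope.

Definition sinc {R : realType} (x : R) : R :=
  if x == 0 then 1 else sin (pi * x) / (pi * x).

(* modulus of a complex number, as a real number: the real part of the
   library's norm `|z| on R[i] (which is real, nonnegative) *)
Definition cmod {R : realType} (z : R[i]) : R := complex.Re `|z|.

Definition energy {R : realType} (f : R -> R[i]) : \bar R :=
  (\int[@lebesgue_measure R]_(t in [set: R]) ((cmod (f t)) ^+ 2)%:E)%E.

Definition sinc_sum {R : realType} (N : nat) (a : 'I_N -> R[i]) (lam : 'I_N -> R)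
  (t : R) : R[i] :=
  \sum_(n < N) a n * ((sinc (t - lam n))%:C)%C.

(* Main.v *)
Require Import Defs.
From mathcomp Require Import all_boot all_order all_algebra.
From mathcomp Require Import all_classical all_reals all_analysis.
From mathcomp Require Import complex.
From mathcomp Require Import measurable_realfun ring lra.
Import Order.TTheory GRing.Theory Num.Theory.
Import numFieldNormedType.Exports.
Local Open Scope classical_set_scope.
Local Open Scope ring_scope.

(** Splitting the coefficients into real and imaginary parts, it suffices to treat
    real coefficients [x]. The energy is then the Gram form
    [sum_(i, j) x_i x_j sinc (lam_i - lam_j)]: products of shifted sincs have explicit
    primitives in terms of a primitive of [sinc] (whose limit [1/2] at infinity comes
    from comparing [n^2 sinc^2 (n x)] with the Fejer kernel) and of
    [sin (pi s) sinc s].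

    The off-diagonal part of the Gram form is [2 / pi p^T H q] with
    [p_i = x_i sin (pi lam_i)], [q_i = x_i cos (pi lam_i)] and the antisymmetric
    Hilbert matrix
    [H_ij = 1 / (lam_i - lam_j)]. As in Montgomery and Vaughan, evaluating [H^2] by
    partial fractions on a pair of singular vectors gives
    [||H||^2 <= 3 max_i sum_j (lam_i - lam_j)^-2 <= 10 / gamma^2], where
    [sum_k k^-2 <= 5/3] is used, and [10 <= pi^2 (1/3 + pi^2 / 12)]. *)

(** * Hilbert's inequality for separated points *)

Section HilbertMatrix.
Context {R : realType} {N : nat} (lam : 'I_N -> R).
Hypothesis lam_inj : injective lam.

(* [hilb i i = 0], because [0^-1 = 0]. *)
Definition hilb (i j : 'I_N) : R := (lam i - lam j)^-1.

Definition hilb_mul (v : 'I_N -> R) (i : 'I_N) : R := \sum_j hilb i j * v j.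

Definition hilb_row (i : 'I_N) : R := \sum_j hilb i j.

Definition hilb_sq (i : 'I_N) : R := \sum_j hilb i j ^+ 2.

Lemma hilbN i j : hilb j i = - hilb i j.
Proof. by rewrite /hilb -opprB invrN. Qed.

Lemma hilb_diag i : hilb i i = 0.
Proof. by rewrite /hilb subrr invr0. Qed.

Lemma lam_sub_neq0 i j : i != j -> lam i - lam j != 0.
Proof. by rewrite subr_eq0 => /eqP ij; apply/eqP => /lam_inj. Qed.

(* Partial fractions: 1/((x-z)(z-y)) = (1/(x-y)) (1/(x-z) + 1/(z-y)). *)
Lemma hilb_square i j :
  \sum_k hilb i k * hilb k j =
  hilb i j * (hilb_row i - hilb_row j) - 2 * hilb i j ^+ 2
  - (if i == j then hilb_sq i else 0).
Proof.
have [<-|ij] := eqVneq i j.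
  rewrite hilb_diag mul0r expr0n mulr0 subr0 sub0r -sumrN.
  by apply: eq_bigr => k _; rewrite (hilbN i k) mulrN expr2.
rewrite subr0.
have -> : hilb_row i - hilb_row j = \sum_k (hilb i k + hilb k j).
  rewrite /hilb_row -sumrB; apply: eq_bigr => k _.
  by rewrite (hilbN k j) opprK.
(* The indices [k = i] and [k = j] vanish on the left, as [hilb] is 0 on the diagonal. On the right
   each contributes [hilb i j] to the bracket, which accounts for the correction
   [2 * hilb i j ^+ 2]. *)
rewrite (bigD1 i)//= (bigD1 j) 1?eq_sym//=.
rewrite [in RHS](bigD1 i)//= [in RHS](bigD1 j) 1?eq_sym//= !hilb_diag.
set A := \sum_(_ < _ | _) _; set B := \sum_(_ < _ | _) _.
suff -> : A = hilb i j * B by ring.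
rewrite /A /B mulr_sumr; apply: eq_bigr => k /andP[ki kj].
have kin : lam i - lam k != 0 by rewrite lam_sub_neq0// eq_sym.
have kjn := lam_sub_neq0 _ _ kj; have ijn := lam_sub_neq0 _ _ ij.
by rewrite /hilb; field; rewrite kin kjn ijn.
Qed.

Lemma hilb_mul_antisym v w :
  \sum_i v i * hilb_mul w i = - \sum_i hilb_mul v i * w i.
Proof.
rewrite /hilb_mul -sumrN.
under eq_bigr do rewrite mulr_sumr.
rewrite exchange_big/=; apply: eq_bigr => i _.
rewrite mulr_suml -sumrN; apply: eq_bigr => j _.
by rewrite (hilbN i j); ring.
Qed.

(* The term with [hilb_row] has opposite signs for [(v, w, M)] and for
   [(w, v, - M)], so it disappears when both identities are added. *)
Lemma hilb_singular_sq (M : R) v w :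
  (forall i, hilb_mul v i = M * w i) ->
  (forall i, hilb_mul w i = - M * v i) ->
  M ^+ 2 * \sum_i v i ^+ 2 =
  - 2 * M * (\sum_i hilb_row i * v i * w i) + \sum_i hilb_sq i * v i ^+ 2
  + 2 * \sum_i \sum_j hilb i j ^+ 2 * (v i * v j).
Proof.
move=> Hv Hw.
(* Here [M^2 v = - M (H w) = - H (H v)], and [H^2] is expanded by [hilb_square]. *)
have E i : M ^+ 2 * v i = - hilb_row i * M * w i +
    hilb_mul (fun j => hilb_row j * v j) i
    + 2 * (\sum_j hilb i j ^+ 2 * v j) + hilb_sq i * v i.
  have -> : M ^+ 2 * v i = - \sum_k hilb i k * hilb_mul v k.
    transitivity (- (M * hilb_mul w i)); first by rewrite Hw; ring.
    rewrite /hilb_mul mulr_sumr; congr (- _); apply: eq_bigr => k _.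
    by rewrite -/(hilb_mul v k) Hv; ring.
  have -> : \sum_k hilb i k * hilb_mul v k =
      \sum_j (\sum_k hilb i k * hilb k j) * v j.
    rewrite /hilb_mul; under eq_bigr do rewrite mulr_sumr.
    rewrite exchange_big/=; apply: eq_bigr => j _.
    by rewrite mulr_suml; apply: eq_bigr => k _; ring.
  under eq_bigr do rewrite hilb_square.
  rewrite mulNr mulNr -mulrA -Hv /hilb_mul !mulr_sumr -!sumrN.
  rewrite -big_split/= -big_split/=.
  have -> : hilb_sq i * v i = \sum_j (if i == j then hilb_sq i else 0) * v j.
    rewrite (bigD1 i)//= eqxx big1 ?addr0// => j ji.
    by rewrite eq_sym (negbTE ji) mul0r.
  by rewrite -big_split/=; apply: eq_bigr => j _; ring.
have -> : M ^+ 2 * \sum_i v i ^+ 2 = \sum_i v i * (M ^+ 2 * v i).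
  by rewrite mulr_sumr; apply: eq_bigr => i _; ring.
(* The two [hilb_row] terms are equal after summation: antisymmetry moves [hilb] onto the outer [v],
   turning it into [M * w]. *)
have -> : - 2 * M * (\sum_i hilb_row i * v i * w i) =
    \sum_i v i * (- hilb_row i * M * w i) +
    \sum_i v i * hilb_mul (fun j => hilb_row j * v j) i.
  rewrite hilb_mul_antisym mulr_sumr -sumrN -big_split/=.
  by apply: eq_bigr => i _; rewrite Hv; ring.
rewrite mulr_sumr -!big_split/=; apply: eq_bigr => i _.
rewrite E !mulrDr -!addrA; congr (_ + (_ + _)); rewrite addrC; congr (_ + _).
  ring.
by rewrite mulrCA mulr_sumr; congr (_ * _); apply: eq_bigr => j _; ring.
Qed.

(** Schur test: the weights [hilb i j ^+ 2] are nonnegative and symmetric, and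
    [v_i v_j <= (v_i^2 + v_j^2) / 2]. *)
Lemma hilb_sq_schur v :
  \sum_i \sum_j hilb i j ^+ 2 * (v i * v j) <= \sum_i hilb_sq i * v i ^+ 2.
Proof.
have <- : \sum_i \sum_j hilb i j ^+ 2 * ((v i ^+ 2 + v j ^+ 2) / 2) =
    \sum_i hilb_sq i * v i ^+ 2.
  have -> : \sum_i \sum_j hilb i j ^+ 2 * ((v i ^+ 2 + v j ^+ 2) / 2) =
    2^-1 * \sum_i \sum_j hilb i j ^+ 2 * v i ^+ 2 +
    2^-1 * \sum_i \sum_j hilb i j ^+ 2 * v j ^+ 2.
    rewrite !mulr_sumr -big_split/=; apply: eq_bigr => i _.
    rewrite !mulr_sumr -big_split/=; apply: eq_bigr => j _.
    by field.
  have -> : \sum_i \sum_j hilb i j ^+ 2 * v j ^+ 2 =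
      \sum_i \sum_j hilb i j ^+ 2 * v i ^+ 2.
    rewrite exchange_big/=; apply: eq_bigr => i _; apply: eq_bigr => j _.
    by rewrite hilbN sqrrN.
  under eq_bigr do rewrite -mulr_suml -/(hilb_sq _).
  by rewrite /hilb_sq; field.
apply: ler_sum => i _; apply: ler_sum => j _.
apply: ler_wpM2l; first exact: sqr_ge0.
have := sqr_ge0 (v i - v j); nra.
Qed.

(** Of the factor 3, one part comes from the [hilb_sq] term and two from the doubled double sum,
    bounded by [hilb_sq_schur]. *)
Lemma hilb_singular_le (M D : R) v w :
  (forall i, hilb_sq i <= D) ->
  (forall i, hilb_mul v i = M * w i) ->
  (forall i, hilb_mul w i = - M * v i) ->
  M ^+ 2 * (\sum_i v i ^+ 2 + \sum_i w i ^+ 2) <=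
  3 * D * (\sum_i v i ^+ 2 + \sum_i w i ^+ 2).
Proof.
move=> hD Hv Hw.
have Ev := hilb_singular_sq _ _ _ Hv Hw.
have := hilb_singular_sq (- M) w v Hw.
rewrite opprK => /(_ Hv); rewrite sqrrN => Ew.
have Sw := hilb_sq_schur w; have Sv := hilb_sq_schur v.
have bD u : \sum_i hilb_sq i * u i ^+ 2 <= D * \sum_i u i ^+ 2.
  rewrite mulr_sumr; apply: ler_sum => i _.
  by apply: ler_wpM2r => //; exact: sqr_ge0.
have bv := bD v; have bw := bD w.
have X : \sum_i hilb_row i * v i * w i = \sum_i hilb_row i * w i * v i.
  by apply: eq_bigr => i _; ring.
rewrite mulrDr Ev Ew X; lra.
Qed.

End HilbertMatrix.

(** * Attainment and size of the operator norm of the Hilbert matrix *)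

Lemma continuous_sumr (R : realType) (T : topologicalType) (I : Type) (r : seq I)
    (F : I -> T -> R) : (forall i, continuous (F i)) ->
  continuous (fun x => \sum_(i <- r) F i x).
Proof.
move=> cF; elim: r => [|i r IH].
  by under eq_fun do rewrite big_nil; move=> x; exact: cvg_cst.
under eq_fun do rewrite big_cons.
by move=> x; apply: (@cvgD _ R^o); [exact: cF|exact: IH].
Qed.

Lemma continuous_mulr (R : realType) (T : topologicalType) (f g : T -> R) :
  continuous f -> continuous g -> continuous (fun x => f x * g x).
Proof. by move=> cf cg x; apply: cvgM; [exact: cf|exact: cg]. Qed.

Section HilbertNorm.
Context {R : realType} {N : nat} (lam : 'I_N -> R).
Hypothesis lam_inj : injective lam.


Lemma continuous_norm2 :
  continuous (fun x : 'rV[R]_N => \sum_i x 0 i ^+ 2).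
Proof.
apply: continuous_sumr => i; under eq_fun do rewrite expr2.
by apply: continuous_mulr; exact: coord_continuous.
Qed.

Lemma sphere_compact :
  compact [set x : 'rV[R]_N | \sum_i x 0 i ^+ 2 = 1].
Proof.
apply: bounded_closed_compact.
  exists 1; split => // M M1 x /= x1.
  apply: le_trans (ltW M1).
  (* The norm on row vectors is the largest absolute value of an entry. *)
  rewrite [leLHS]/Num.norm/= mx_normrE; apply/bigmax_leP; split => //= -[i j] _ /=.
  rewrite ord1 -(@expr_le1 _ 2)// real_normK ?num_real//.
  rewrite -x1 (bigD1 j)//= lerDl; apply: sumr_ge0 => k _; exact: sqr_ge0.
apply: (@closed_comp _ _ _ [set (1 : R)]).
  by move=> x _; exact: continuous_norm2.
exact: closed_eq.
Qed.

Lemma hilb_mulZ c v i : hilb_mul lam (fun j => c * v j) i = c * hilb_mul lam v i.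
Proof. by rewrite /hilb_mul mulr_sumr; apply: eq_bigr => j _; rewrite mulrCA. Qed.

(** The continuous function [|H x|^2] has a maximum on the compact unit sphere, which is nonempty as
    [0 < N]; homogeneity extends the bound to all [w]. *)
Lemma hilb_norm_attained : (0 < N)%N ->
  exists v : 'I_N -> R, [/\ \sum_i v i ^+ 2 = 1 &
   forall w, \sum_i hilb_mul lam w i ^+ 2 <=
     (\sum_i hilb_mul lam v i ^+ 2) * \sum_i w i ^+ 2].
Proof.
move=> N0.
pose F (x : 'rV[R]_N) := \sum_i hilb_mul lam (fun j => x 0 j) i ^+ 2.
have cF : continuous F.
  have cH i : continuous (fun x : 'rV[R]_N => hilb_mul lam (fun j => x 0 j) i).
    apply: continuous_sumr => j; apply: continuous_mulr; first exact: cst_continuous.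
    exact: coord_continuous.
  apply: continuous_sumr => i; under eq_fun do rewrite expr2.
  by apply: continuous_mulr; exact: cH.
have S0 : ([set x : 'rV[R]_N | \sum_i x 0 i ^+ 2 = 1] !=set0)%classic.
  exists (delta_mx 0 (Ordinal N0)); rewrite /= (bigD1 (Ordinal N0))//=.
  rewrite mxE !eqxx expr1n big1 ?addr0// => i /negbTE iN.
  by rewrite mxE iN andbF expr0n.
have [c /set_mem /= c1 cmax] :=
  EVT_max_rV S0 sphere_compact (continuous_subspaceT cF).
exists (fun j => c 0 j); split => // w.
have [w0|w0] := eqVneq (\sum_i w i ^+ 2) 0.
  have {}w0 i : w i = 0.
    move/eqP: w0; rewrite psumr_eq0; last by move=> ? _; exact: sqr_ge0.
    by move/allP => /(_ i); rewrite mem_index_enum sqrf_eq0 => /(_ isT)/eqP.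
  rewrite [X in _ <= _ * X]big1 ?mulr0; last by move=> i _; rewrite w0 expr0n.
  rewrite big1// => i _.
  by rewrite /hilb_mul big1 ?expr0n// => j _; rewrite w0 mulr0.
have w1 : 0 < \sum_i w i ^+ 2.
  by rewrite lt_def w0/=; apply: sumr_ge0 => ? _; exact: sqr_ge0.
set s := Num.sqrt (\sum_i w i ^+ 2).
have s2 : s ^+ 2 = \sum_i w i ^+ 2 by rewrite sqr_sqrtr// ltW.
have sn0 : s != 0 by rewrite sqrtr_eq0 -ltNge.
pose x : 'rV[R]_N := \row_j (s^-1 * w j).
have x1 : x \in ([set x : 'rV[R]_N | \sum_i x 0 i ^+ 2 = 1])%classic.
  rewrite inE/=; under eq_bigr do rewrite mxE exprMn.
  by rewrite -mulr_sumr -s2 exprVn mulVf// expf_neq0.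
have := cmax _ x1.
have -> : F x = s^-1 ^+ 2 * \sum_i hilb_mul lam w i ^+ 2.
  rewrite /F mulr_sumr; apply: eq_bigr => i _.
  rewrite -exprMn -hilb_mulZ; congr (_ ^+ 2); apply: eq_bigr => j _.
  by rewrite mxE.
by rewrite exprVn s2 mulrC ler_pdivrMr.
Qed.

(** For a maximiser [v] with [M = |H v|] and [p = H v / M], maximality and antisymmetry force
    [H p = - M v]. So [(v, p)] is a singular pair and [hilb_singular_le] gives [M^2 <= 3 D]. *)
Lemma hilb_norm_le (D : R) : (forall i, hilb_sq lam i <= D) ->
  forall w, \sum_i hilb_mul lam w i ^+ 2 <= 3 * D * \sum_i w i ^+ 2.
Proof.
move=> hD w.
case: (posnP N) => [N0|N0].
  have no (i : 'I_N) : False.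
    by have := leq_ltn_trans (leq0n i) (ltn_ord i); rewrite N0.
  by rewrite !big1 ?mulr0// => i; case: (no i).
have [v [v1 vmax]] := hilb_norm_attained N0.
apply: (le_trans (vmax w)); apply: ler_wpM2r.
  by apply: sumr_ge0 => ? _; exact: sqr_ge0.
set M2 := \sum_i hilb_mul lam v i ^+ 2.
have M20 : 0 <= M2 by apply: sumr_ge0 => ? _; exact: sqr_ge0.
set M := Num.sqrt M2.
have MM : M ^+ 2 = M2 by rewrite sqr_sqrtr.
have [M0|Mn0] := eqVneq M 0.
  rewrite -MM M0 expr0n mulr_ge0//; apply: le_trans (hD (Ordinal N0)).
  by apply: sumr_ge0 => ? _; exact: sqr_ge0.
pose p i := M^-1 * hilb_mul lam v i.
have Hv i : hilb_mul lam v i = M * p i by rewrite /p mulrA divff// mul1r.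
have p1 : \sum_i p i ^+ 2 = 1.
  under eq_bigr do rewrite /p exprMn.
  by rewrite -mulr_sumr -/M2 -MM exprVn mulVf// expf_neq0.
(* Since [M] is the norm of the antisymmetric [hilb], the square
   [|hilb p + M v|^2 <= M^2 - 2 M^2 + M^2] vanishes. *)
have /eqP : \sum_i (hilb_mul lam p i + M * v i) ^+ 2 = 0.
  apply/eqP; rewrite eq_le; apply/andP; split; last first.
    by apply: sumr_ge0 => ? _; exact: sqr_ge0.
  have -> : \sum_i (hilb_mul lam p i + M * v i) ^+ 2 =
      \sum_i hilb_mul lam p i ^+ 2 + 2 * M * (\sum_i v i * hilb_mul lam p i)
      + M ^+ 2 * \sum_i v i ^+ 2.
    rewrite !mulr_sumr -!big_split/=; apply: eq_bigr => i _; ring.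
  rewrite v1 hilb_mul_antisym.
  have -> : \sum_i hilb_mul lam v i * p i = M * \sum_i p i ^+ 2.
    rewrite mulr_sumr; apply: eq_bigr => i _; rewrite Hv; ring.
  rewrite p1; have := vmax p; rewrite p1 -/M2 -MM; nra.
rewrite psumr_eq0; last by move=> ? _; exact: sqr_ge0.
move/allP => Hp.
have {}Hp i : hilb_mul lam p i = - M * v i.
  have := Hp i; rewrite mem_index_enum sqrf_eq0 addr_eq0 => /(_ isT)/eqP ->.
  by rewrite mulNr.
have := hilb_singular_le _ lam_inj M D v p hD Hv Hp.
by rewrite v1 p1 MM ler_pM2r// addr_gt0.
Qed.

(** Expanding [|K p - e H q|^2 >= 0] for a sign [e], then using [|H q| <= K |q|] and dividing by
    [K]. *)
Lemma bilinear_hilb_le (D : R) (p q : 'I_N -> R) :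
  (forall i, hilb_sq lam i <= D) ->
  `|\sum_i p i * hilb_mul lam q i| * 2 <=
   Num.sqrt (3 * D) * (\sum_i p i ^+ 2 + \sum_i q i ^+ 2).
Proof.
move=> hD; have := hilb_norm_le _ hD q.
set K := Num.sqrt _ => Hq.
have K0 : 0 <= K by exact: sqrtr_ge0.
have SK : 3 * D * \sum_i q i ^+ 2 <= K ^+ 2 * \sum_i q i ^+ 2.
  apply: ler_wpM2r; first by apply: sumr_ge0 => ? _; exact: sqr_ge0.
  (* When [N = 0] the hypothesis does not determine the sign of [D], and [Num.sqrt] is 0 on negative
     numbers. *)
  have [h|h] := leP 0 (3 * D); first by rewrite sqr_sqrtr.
  by apply: (le_trans (ltW h)); exact: sqr_ge0.
have [K00|Kn0] := eqVneq K 0.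
  have : \sum_i hilb_mul lam q i ^+ 2 == 0.
    rewrite eq_le; apply/andP; split; first by move: Hq SK; rewrite K00; lra.
    by apply: sumr_ge0 => ? _; exact: sqr_ge0.
  rewrite psumr_eq0; last by move=> ? _; exact: sqr_ge0.
  move/allP => H0; rewrite big1 ?normr0 ?K00 ?mul0r// => i _.
  have := H0 i; rewrite mem_index_enum sqrf_eq0 => /(_ isT)/eqP ->.
  by rewrite mulr0.
have Kp : 0 < K by rewrite lt_def Kn0.
have A (e : R) : e ^+ 2 = 1 -> e * (\sum_i p i * hilb_mul lam q i) * 2 <=
   K * (\sum_i p i ^+ 2 + \sum_i q i ^+ 2).
  move=> e2.
  have : 0 <= \sum_i (K * p i - e * hilb_mul lam q i) ^+ 2.
    by apply: sumr_ge0 => ? _; exact: sqr_ge0.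
  have -> : \sum_i (K * p i - e * hilb_mul lam q i) ^+ 2 =
      K ^+ 2 * (\sum_i p i ^+ 2) - 2 * K * e * (\sum_i p i * hilb_mul lam q i)
      + e ^+ 2 * \sum_i hilb_mul lam q i ^+ 2.
    rewrite !mulr_sumr -sumrN -!big_split/=; apply: eq_bigr => i _; ring.
  rewrite e2 => h; rewrite -(ler_pM2l Kp); move: h Hq SK.
  set P := \sum_i p i ^+ 2; set Q := \sum_i q i ^+ 2; nra.
have [h|h] := ger0P (\sum_i p i * hilb_mul lam q i).
  by have := A 1; rewrite expr1n mul1r => /(_ erefl).
by have := A (-1); rewrite sqrrN expr1n mulN1r => /(_ erefl).
Qed.

End HilbertNorm.

(** * Sums of inverse squares over separated points *)

Section Separated.
Context {R : realType}.

(* Telescoping: 1/k^2 <= 1/(k - 1/2) - 1/(k + 1/2). *)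
Lemma sum_inv_sqr_le n :
  \sum_(k < n.+2) (k%:R : R)^-1 ^+ 2 <= 5 / 3 - (n%:R + 3 / 2)^-1.
Proof.
elim: n => [|n IH].
  (* The term [k = 0] is 0 since [0^-1 = 0]; the base case is the equality [1 = 5/3 - 2/3]. *)
  rewrite big_ord_recr big_ord_recr big_ord0 /= invr0 invr1 expr0n expr1n.
  by rewrite !add0r invf_div; lra.
rewrite big_ord_recr/= (le_trans (lerD IH (lexx _)))//.
have n0 : 0 <= n%:R :> R by exact: ler0n.
have -> : n.+1%:R = n%:R + 1 :> R by rewrite natr1.
have -> : n.+2%:R = n%:R + 2 :> R by rewrite -natrD addn2.
rewrite -subr_ge0.
(* The numerator is [(n + 2)^2 - (n + 3/2) (n + 5/2) = 1/4]. *)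
have -> : 5 / 3 - (n%:R + 1 + 3 / 2)^-1 -
    (5 / 3 - (n%:R + 3 / 2)^-1 + (n%:R + 2)^-1 ^+ 2) =
    (1 / 4) / ((n%:R + 3 / 2) * (n%:R + 5 / 2) * (n%:R + 2) ^+ 2) :> R.
  by field; rewrite !gt_eqF//; lra.
by apply: divr_ge0; [lra|rewrite mulr_ge0// ?sqr_ge0// mulr_ge0//; lra].
Qed.

Lemma sum_inv_sqr_bound n : \sum_(k < n) (k%:R : R)^-1 ^+ 2 <= 5 / 3.
Proof.
apply: (@le_trans _ _ (\sum_(k < n.+2) (k%:R : R)^-1 ^+ 2)).
  rewrite !big_ord_recr/= -addrA lerDl addr_ge0//; exact: sqr_ge0.
apply: le_trans (sum_inv_sqr_le n) _.
by rewrite lerBlDr lerDl invr_ge0; have : 0 <= n%:R :> R by []; lra.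
Qed.

(** Grouping the indices by the value of [g], each fibre has at most one element, so the sum is at
    most the sum over all [k < K]. *)
Lemma sum_inv_sqr_inj (I : finType) (P : pred I) (g : I -> nat) :
  {in P &, injective g} ->
  \sum_(i | P i) (g i)%:R^-1 ^+ 2 <= (5 / 3 : R).
Proof.
move=> ginj.
pose K := (\max_(i | P i) g i).+1.
apply: le_trans (sum_inv_sqr_bound K).
have -> : \sum_(i | P i) (g i)%:R^-1 ^+ 2 =
    \sum_(i | P i) \sum_(k < K | g i == k) k%:R^-1 ^+ 2 :> R.
  apply: eq_bigr => i Pi.
  have gK : (g i < K)%N by rewrite ltnS; exact: leq_bigmax_cond.
  rewrite (bigD1 (Ordinal gK)) ?eqxx//= big1 ?addr0// => k /andP[/eqP gk].
  by rewrite -val_eqE/= gk eqxx.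
rewrite (exchange_big_dep predT)//=.
apply: ler_sum => k _.
have [i /andP[Pi gi]|no] := pickP (fun i => P i && (g i == k)).
  rewrite (bigD1 i) ?Pi ?gi//= big1 ?addr0// => j /andP[/andP[Pj gj]].
  by rewrite (ginj j i Pj Pi) ?eqxx// (eqP gi) (eqP gj).
by rewrite big_pred0 ?sqr_ge0.
Qed.

(* Points of [1, +oo[ at mutual distance >= 1 have distinct integer parts. *)
Lemma sum_inv_sqr_sep (I : finType) (P : pred I) (y : I -> R) :
  (forall i, P i -> 1 <= y i) ->
  (forall i j, P i -> P j -> i != j -> 1 <= `|y i - y j|) ->
  \sum_(i | P i) (y i)^-1 ^+ 2 <= 5 / 3.
Proof.
move=> y1 ysep.
have trunc i : P i -> (Num.truncn (y i))%:R <= y i < (Num.truncn (y i)).+1%:R.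
  by move=> /y1 yi; apply: truncn_itv; lra.
apply: le_trans (sum_inv_sqr_inj I P (fun i => Num.truncn (y i)) _).
  apply: ler_sum => i Pi; have /andP[h1 h2] := trunc i Pi.
  have h3 := y1 i Pi.
  have h4 : 0 < (Num.truncn (y i))%:R :> R.
    rewrite ltr0n truncn_gt0//.
  have h5 : (y i)^-1 <= (Num.truncn (y i))%:R^-1 by rewrite lef_pV2// posrE; lra.
  by rewrite lerXn2r// nnegrE invr_ge0//; lra.
move=> i j Pi Pj e; apply/eqP; apply/negPn/negP => ij.
have := ysep i j Pi Pj ij; rewrite leNgt => /negP; apply.
have /andP[h1 h2] := trunc i Pi; have /andP[h3 h4] := trunc j Pj.
move: h2 h4 h1 h3; rewrite e -natr1 ltr_norml => h2 h4 h1 h3.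
by apply/andP; split; lra.
Qed.

(** The points on one side of [lam i], recentred there and divided by [gamma], satisfy
    [sum_inv_sqr_sep]. Each side contributes at most [(5/3) / gamma^2]; in [side], the sign [e]
    selects the side. *)
Lemma hilb_sq_le (N : nat) (lam : 'I_N -> R) (gamma : R) :
  0 < gamma ->
  (forall n m : 'I_N, n != m -> gamma <= `|lam n - lam m|) ->
  forall i, hilb_sq lam i <= 10 / (3 * gamma ^+ 2).
Proof.
move=> g0 sep i.
have side (e : R) (P : pred 'I_N) : e ^+ 2 = 1 ->
    (forall j, P j -> (j != i) && (0 <= e * (lam j - lam i))) ->
    \sum_(j | P j) hilb lam i j ^+ 2 <= 5 / 3 / gamma ^+ 2.
  move=> e2 hP.
  have ne : `|e| = 1.
    apply/eqP; rewrite -(@eqrXn2 _ 2)// real_normK ?num_real// e2.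
    by rewrite expr1n.
  pose y j := e * (lam j - lam i) / gamma.
  have -> : \sum_(j | P j) hilb lam i j ^+ 2 =
      (\sum_(j | P j) (y j)^-1 ^+ 2) / gamma ^+ 2.
    rewrite mulr_suml; apply: eq_bigr => j _.
    rewrite hilbN sqrrN /hilb -!exprVn -exprMn /y !invfM invrK.
    have -> : e^-1 = e.
      have e0 : e != 0 by rewrite -normr_eq0 ne oner_eq0.
      by apply: (mulfI e0); rewrite divff// -expr2 e2.
    rewrite mulfK ?gt_eqF// exprMn e2 mul1r//.
  apply: ler_wpM2r; first by rewrite invr_ge0 sqr_ge0.
  apply: sum_inv_sqr_sep => [j|j k] Pj.
    have /andP[ji h] := hP _ Pj; rewrite ler_pdivlMr// mul1r.
    by rewrite -(ger0_norm h) normrM ne mul1r; exact: sep.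
  move=> Pk jk; rewrite /y -mulrBl -mulrBr normrM normrM ne mul1r.
  rewrite (gtr0_norm (_ : 0 < gamma^-1)) ?invr_gt0// ler_pdivlMr// mul1r.
  have -> : lam j - lam i - (lam k - lam i) = lam j - lam k by ring.
  exact: sep.
rewrite /hilb_sq (bigID (fun j => (lam i <= lam j) && (j != i)))/=.
have -> : 10 / (3 * gamma ^+ 2) = 5 / 3 / gamma ^+ 2 + 5 / 3 / gamma ^+ 2.
  by field; rewrite gt_eqF.
apply: lerD.
  by apply: (side 1); rewrite ?expr1n// => j /andP[h ->]; rewrite mul1r subr_ge0.
rewrite (bigID (fun j => j == i))/= big1 ?add0r; last first.
  by move=> j /andP[_ /eqP ->]; rewrite hilb_diag expr0n.
apply: (side (-1)); rewrite ?sqrrN ?expr1n// => j /andP[+ ji].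
by rewrite ji andbT -ltNge mulN1r opprB subr_ge0 => /ltW.
Qed.

(** * Elementary bounds for sine, cosine and pi *)

Lemma is_derive_continuous (f : R -> R) (x d : R) :
  is_derive x 1 f d -> {for x, continuous f}.
Proof. by move=> fd; exact/differentiable_continuous/derivable1_diffP. Qed.

Lemma MVT_derive (f df : R -> R) (a b : R) :
  (forall x : R, is_derive x 1 f (df x)) -> a <= b ->
  exists2 c, a <= c <= b & f b - f a = df c * (b - a).
Proof.
move=> fd ab.
have cf : {within `[a, b], continuous f}.
  by apply: continuous_subspaceT => y; exact: is_derive_continuous (fd y).
have [c cab e] := MVT_segment ab (fun x _ => fd x) cf.
by exists c => //; move: cab; rewrite in_itv.
Qed.

Lemma sin_le_id (x : R) : 0 <= x -> sin x <= x.
Proof.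
move=> x0; rewrite -subr_ge0.
have fd (y : R) : is_derive y 1 (fun y : R => y - sin y) (1 - cos y).
  by apply: is_deriveB.
have [c _] := MVT_derive _ _ _ _ fd x0.
rewrite sin0 !subr0 => ->; rewrite mulr_ge0// subr_ge0; exact: cos_le1.
Qed.

Lemma cos_ge (x : R) : 0 <= x -> 1 - x ^+ 2 / 2 <= cos x.
Proof.
move=> x0.
have -> : cos x = 1 - 2 * sin (x / 2) ^+ 2.
  rewrite [in LHS](_ : x = x / 2 + x / 2); last by field.
  rewrite cosD; have := cos2Dsin2 (x / 2); rewrite !expr2; lra.
rewrite lerD2l lerN2.
have h : sin (x / 2) <= x / 2 by apply: sin_le_id; rewrite divr_ge0.
have h' : 0 <= x / 2 by rewrite divr_ge0.
have := @sin_ge0_pi _ (x / 2).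
have [xp hs|xp _] := leP (x / 2) pi.
  have : 0 <= sin (x / 2) by apply: hs; apply/andP; split.
  nra.
(* Beyond [pi], where the sine may be negative, [sin^2 <= 1 <= (x / 2)^2] suffices. *)
have := @sin_le1 _ (x / 2); have := @sin_geN1 _ (x / 2).
have := pi_ge2 R; nra.
Qed.

(** A lower bound on [pi^2] strong enough for [10 <= pi^2 (1/3 + pi^2 / 12)]. It compares
    [cos (pi / 6) = sqrt 3 / 2 < 87/100] with [cos_ge]; the constant is [72 (1 - 87/100)]. *)
Lemma pi_sq_ge : 936 / 100 <= pi ^+ 2 :> R.
Proof.
have p2 := pi_ge2 R.
have c0 : 0 < cos (pi / 6 : R) by apply: cos_gt0_pihalf; apply/andP; split; lra.
(* [cos (3 y) = cos y (4 cos^2 y - 3)] vanishes at [y = pi / 6]. *)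
have : cos (pi / 6 : R) ^+ 2 = 3 / 4.
  have := @cos_pihalf R.
  rewrite (_ : pi / 2 = pi / 6 + (pi / 6 + pi / 6) :> R); last by field.
  rewrite !cosD !sinD => h.
  have := cos2Dsin2 (pi / 6 : R).
  move: h c0; set c := cos _; set s := sin _ => h c0 cs.
  have {}h : c * (4 * c ^+ 2 - 3) = 0.
    rewrite -h (_ : s * (s * c + c * s) = 2 * c * s ^+ 2); last by ring.
    have -> : s ^+ 2 = 1 - c ^+ 2 by rewrite -cs; ring.
    have -> : s * s = 1 - c ^+ 2 by rewrite -cs; ring.
    ring.
  move/eqP: h; rewrite mulf_eq0 (gt_eqF c0)/= => /eqP; lra.
have := cos_ge (pi / 6); set c := cos _; rewrite leNgt => /(_ ltac:(lra)) h1 h2.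
apply/negP => h3.
have : 87 / 100 <= c by move: h1; rewrite expr_div_n; lra.
nra.
Qed.

End Separated.

(** * Lower bound for the real Gram form of shifted sincs *)

Section RealInequality.
Context {R : realType} {N : nat} (lam : 'I_N -> R) (gamma : R).
Hypothesis gamma_gt0 : 0 < gamma.
Hypothesis lam_sep : forall n m : 'I_N, n != m -> gamma <= `|lam n - lam m|.

Let lam_inj : injective lam.
Proof.
move=> i j e; apply/eqP/negPn/negP => /lam_sep.
by rewrite e subrr normr0 leNgt gamma_gt0.
Qed.

Lemma sinc_gram_ge (x : 'I_N -> R) :
  (1 - gamma^-1 * Num.sqrt (3^-1 + pi ^+ 2 / 12)) * \sum_i x i ^+ 2 <=
  \sum_i \sum_j x i * x j * sinc (lam i - lam j).
Proof.
(* [sin (pi (lam i - lam j)) = s_i c_j - c_i s_j] turns the off-diagonal part into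
   the bilinear form [2 / pi p^T hilb q]. *)
pose p i := x i * sin (pi * lam i).
pose q i := x i * cos (pi * lam i).
have pi0 := @pi_gt0 R.
have -> : \sum_i \sum_j x i * x j * sinc (lam i - lam j) =
    \sum_i x i ^+ 2 + 2 / pi * \sum_i p i * hilb_mul lam q i.
  (* The form is written as two halves, one transposed by antisymmetry, so that the summands match
     [s_i c_j - c_i s_j] termwise. *)
  have -> : 2 / pi * (\sum_i p i * hilb_mul lam q i) =
     \sum_i pi^-1 * (p i * hilb_mul lam q i)
     - \sum_i pi^-1 * (q i * hilb_mul lam p i).
    rewrite -!mulr_sumr [X in _ - pi^-1 * X]hilb_mul_antisym.
    have -> : \sum_i hilb_mul lam q i * p i = \sum_i p i * hilb_mul lam q i.
      by apply: eq_bigr => i _; rewrite mulrC.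
    have half (a s : R) : a != 0 -> 2 / a * s = a^-1 * s - a^-1 * - s.
      by move=> a0; field.
    by rewrite half// gt_eqF.
  rewrite -sumrB -big_split/=; apply: eq_bigr => i _.
  rewrite /hilb_mul !mulr_sumr -sumrB (bigD1 i)//= [in RHS](bigD1 i)//=.
  rewrite subrr /sinc eqxx hilb_diag !(mul0r, mulr0, mulr1, subr0, add0r) -expr2.
  congr (_ + _). rewrite oppr0 add0r; apply: eq_bigr => j ji.
  have ijn : lam i - lam j != 0 by apply: lam_sub_neq0; rewrite // eq_sym.
  rewrite (negbTE ijn) mulrBr sinB /hilb /p /q.
  have pn0 : pi != 0 :> R by rewrite gt_eqF.
  move: (pi : R) pn0 => c c0.
  by field; rewrite -mulrBr mulf_neq0 ?ijn ?c0.
have := bilinear_hilb_le _ lam_inj _ p q (hilb_sq_le _ _ _ gamma_gt0 lam_sep).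
have -> : \sum_i p i ^+ 2 + \sum_i q i ^+ 2 = \sum_i x i ^+ 2.
  rewrite -big_split/=; apply: eq_bigr => i _.
  by rewrite !exprMn -mulrDr addrC cos2Dsin2 mulr1.
set X := \sum_i x i ^+ 2; set S := \sum_i _; set K := Num.sqrt (3 * _) => hS.
set C := Num.sqrt _.
have X0 : 0 <= X by apply: sumr_ge0 => ? _; exact: sqr_ge0.
(* With [D = 10 / (3 gamma^2)] this is [10 <= pi^2 (1/3 + pi^2 / 12)]. *)
have KC : K <= pi * gamma^-1 * C.
  have -> : pi * gamma^-1 * C = Num.sqrt ((pi * gamma^-1) ^+ 2 * (3^-1 + pi ^+ 2 / 12)).
    rewrite sqrtrM ?sqr_ge0// sqrtr_sqr ger0_norm// mulr_ge0 ?invr_ge0 ?ltW//.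
  apply: ler_wsqrtr.
  rewrite exprMn exprVn (mulrC (pi ^+ 2)) -mulrA.
  have -> : 3 * (10 / (3 * gamma ^+ 2)) = (gamma ^+ 2)^-1 * 10.
    by field; rewrite gt_eqF.
  apply: ler_wpM2l; first by rewrite invr_ge0 sqr_ge0.
  have := @pi_sq_ge R; nra.
have : - `|S| <= S by rewrite lerNl -normrN ler_norm.
have {}hS : `|S| * 2 <= pi * gamma^-1 * C * X.
  by apply: le_trans hS _; exact: ler_wpM2r.
have {}hS : `|S| * 2 / pi <= gamma^-1 * C * X.
  by rewrite ler_pdivrMr//; move: hS; rewrite -!mulrA [in leRHS]mulrC -!mulrA; lra.
move=> h.
have : - `|S| * (2 / pi) <= S * (2 / pi).
  by apply: ler_wpM2r => //; rewrite divr_ge0// ltW.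
lra.
Qed.

End RealInequality.

(** * Primitives of products of sincs *)

Section Calculus.
Context {R : realType}.
Implicit Types (f g : R -> R) (x a b c d : R).

Lemma derive1_add f g x a b : is_derive x 1 f a -> is_derive x 1 g b ->
  is_derive x 1 (fun t => f t + g t) (a + b).
Proof. by move=> fa gb; exact: is_deriveD. Qed.

Lemma derive1_sub f g x a b : is_derive x 1 f a -> is_derive x 1 g b ->
  is_derive x 1 (fun t => f t - g t) (a - b).
Proof. by move=> fa gb; exact: is_deriveB. Qed.

Lemma derive1_scale f x a c : is_derive x 1 f a ->
  is_derive x 1 (fun t => c * f t) (c * a).
Proof. by move=> fa; exact: is_deriveZ. Qed.

Lemma derive1_mul f g x a b : is_derive x 1 f a -> is_derive x 1 g b ->
  is_derive x 1 (fun t => f t * g t) (a * g x + f x * b).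
Proof.
move=> fa gb; have := @is_deriveM R R^o f g x 1 a b fa gb.
by move=> h; apply: is_derive_eq; rewrite addrC [a * _]mulrC.
Qed.

Lemma derive1_affine f x a c d : is_derive (c * x + d) 1 f a ->
  is_derive x 1 (fun t => f (c * t + d)) (c * a).
Proof.
move=> fa.
have ga : is_derive x 1 (fun t : R => c * t + d) c.
  have := derive1_add _ _ _ _ _ (derive1_scale _ _ _ c (is_derive_id x 1))
    (is_derive_cst d x 1).
  by move=> h; apply: is_derive_eq; rewrite mulr1 addr0.
rewrite mulrC.
exact: (@is_derive1_comp _ f (fun t => c * t + d)).
Qed.

Lemma derive1_sum n (h : 'I_n -> R -> R) (dh : 'I_n -> R) x :
  (forall i, is_derive x 1 (h i) (dh i)) ->
  is_derive x 1 (fun t => \sum_(i < n) h i t) (\sum_(i < n) dh i).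
Proof.
move=> hd; have := @is_derive_sum _ _ _ n h x 1 dh hd.
by rewrite (_ : \sum_(i < n) h i = fun t => \sum_(i < n) h i t)//;
  apply/funext => t; rewrite fct_sumE.
Qed.

(** The difference quotient at 0 is [f] itself, so continuity there is enough; this handles the
    removable singularity of [sinc]. *)
Lemma derive1_mulid f : {for (0 : R), continuous f} ->
  is_derive (0 : R) 1 (fun t => t * f t) (f 0).
Proof.
move=> cf; apply/is_derive1_caratheodory; exists f; split => //.
by move=> z; rewrite mul0r !subr0 mulrC.
Qed.

(** Integrals need a finite left end, so the base point [- |x| - 1] moves with [x], staying below
    [x] and 0. By [Jc] the value does not depend on it, and [- |x| - 2] serves as a common base
    point near [x]. *)
Lemma primitive_exists f : continuous f ->
  exists F : R -> R, forall x, is_derive x 1 F (f x).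
Proof.
move=> cf; pose mu := @lebesgue_measure R.
have intf a b : mu.-integrable `[a, b] (EFin \o f).
  apply: continuous_compact_integrable; first exact: segment_compact.
  exact: continuous_subspaceT.
pose J a b : R := (\int[mu]_(t in `[a, b]) f t)%R.
have JB a b x : a <= b -> b <= x -> a <= x ->
    J a x - J a b = (\int[mu]_(t in `]b, x]) f t)%R.
  by move=> ab bx ax; apply: Rintegral_itvB => //; rewrite bnd_simp.
have Jc c c' x : c <= c' -> c' <= x -> c' <= 0 -> J c x - J c 0 = J c' x - J c' 0.
  move=> cc c'x c'0.
  have -> : J c x = J c c' + (J c' x - J c' c').
    rewrite (JB c' c' x)// -(JB c c' x)//; first by ring.
    exact: le_trans c'x.
  have -> : J c 0 = J c c' + (J c' 0 - J c' c').
    rewrite (JB c' c' 0)// -(JB c c' 0)//; first by ring.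
    exact: le_trans c'0.
  ring.
exists (fun x => J (- `|x| - 1) x - J (- `|x| - 1) 0) => x.
pose c := - `|x| - 2.
have Fx : is_derive x 1 (fun t => J c t - J c 0) (f x).
  have cx : c < x.
    by rewrite /c; have := ler_norm (- x); rewrite normrN; lra.
  have [dF eF] := @continuous_FTC1_closed R f c x (x + 1) ltac:(lra)
    (intf c (x + 1)) cx (cf x).
  have : is_derive x 1 (J c) (f x).
    by rewrite -eF derive1E; apply: derivableP.
  move=> h; have := derive1_sub _ _ _ _ _ h (is_derive_cst (J c 0) x 1).
  by rewrite subr0.
apply: near_eq_is_derive Fx; near=> t.
have tx : `|x - t| < 1 by near: t; exact: (@cvgr_dist_lt _ _ _ _ _ id x).
apply: Jc.
- rewrite /c; have := ler_normB x (x - t); rewrite opprB addrC subrK; lra.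
- have := ler_norm (- t); rewrite normrN; lra.
- have := normr_ge0 t; lra.
Unshelve. all: by end_near. Qed.

Lemma cvgy_bound f (l A K : R) :
  (forall x, A < x -> `|f x - l| <= K / (x - A)) -> f x @[x --> +oo] --> l.
Proof.
move=> h; apply/cvgrPdist_le => e e0.
near=> x.
have xA : A < x by near: x; apply: nbhs_pinfty_gt; rewrite num_real.
rewrite distrC (le_trans (h x xA))// ler_pdivrMr ?subr_gt0//.
rewrite -ler_pdivrMl// lerBrDr.
by near: x; apply: nbhs_pinfty_ge; rewrite num_real.
Unshelve. all: by end_near. Qed.

End Calculus.

(** * The sinc function and products of its shifts *)

Section Sinc.
Context {R : realType}.
Implicit Types x y : R.

Let pi_neq0 : pi != 0 :> R. Proof. by rewrite gt_eqF// pi_gt0. Qed.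

Lemma mul_sinc x : pi * x * sinc x = sin (pi * x).
Proof.
rewrite /sinc; have [->|x0] := eqVneq x 0; first by rewrite !mulr0 mul0r sin0.
by rewrite mulrC divfK// mulf_neq0.
Qed.

Lemma sinc0 : sinc 0 = 1 :> R. Proof. by rewrite /sinc eqxx. Qed.

Lemma sincE x : x != 0 -> sinc x = sin (pi * x) / (pi * x).
Proof. by move=> x0; rewrite /sinc (negbTE x0). Qed.

Lemma sincN x : sinc (- x) = sinc x.
Proof.
rewrite /sinc oppr_eq0; case: eqVneq => // x0.
by rewrite mulrN sinN invrN mulrNN.
Qed.

Lemma derive1_sin_scale c x :
  is_derive x 1 (fun t => sin (c * t)) (c * cos (c * x)).
Proof.
have := @derive1_affine R sin x (cos (c * x + 0)) c 0 (is_derive_sin _).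
by rewrite addr0; under eq_fun do rewrite addr0.
Qed.

Lemma derive1_inv x : x != 0 ->
  is_derive x 1 (fun t : R => t^-1) (- (x ^+ 2)^-1).
Proof.
move=> x0; have := @is_deriveV R id x 1 1 x0 (is_derive_id x 1).
by move=> h; apply: is_derive_eq; rewrite [LHS]mulr1.
Qed.

Lemma derive1_sinc x : x != 0 ->
  is_derive x 1 (@sinc R) ((cos (pi * x) - sinc x) / x).
Proof.
move=> x0.
have h := derive1_scale _ _ _ pi^-1
  (derive1_mul _ _ _ _ _ (derive1_sin_scale pi x) (derive1_inv x x0)).
have {}h : is_derive x 1 (fun t => pi^-1 * (sin (pi * t) * t^-1))
    ((cos (pi * x) - sinc x) / x).
  apply: is_derive_eq; rewrite sincE//.
  move: (pi : R) pi_neq0 => c c0; field; rewrite c0 x0//.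
apply: near_eq_is_derive h; near=> t.
have t0 : t != 0 by near: t; apply: (@cvgr_neq0 _ R^o _ _ _ id x).
by rewrite sincE// invfM mulrCA.
Unshelve. all: by end_near. Qed.

Lemma continuous_sinc : continuous (@sinc R).
Proof.
move=> x; have [->|x0] := eqVneq x 0; last first.
  by apply: is_derive_continuous (derive1_sinc _ _).
(* The slope function of [sin (pi t)] at 0 is continuous there and equals [pi * sinc]. *)
have /is_derive1_caratheodory[g [gE cg g0]] := derive1_sin_scale pi 0.
have -> : sinc = (fun t => pi^-1 * g t) :> (R -> R).
  apply/funext => t; have [->|t0] := eqVneq t 0.
    by rewrite sinc0 g0 mulr0 cos0 mulr1 mulVf.
  apply: (mulfI t0); apply: (mulfI pi_neq0).
  rewrite mulrA mul_sinc; have := gE t; rewrite mulr0 sin0 !subr0 => ->.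
  by rewrite (mulrCA t) mulVKf// mulrC.
by apply: cvgM; [exact: cvg_cst|exact: cg].
Qed.

Lemma sinc_bound x : `|sinc x * x| <= 2^-1.
Proof.
have : `|sinc x * x| * pi <= 1.
  rewrite -[X in _ * X <= _](ger0_norm (@pi_ge0 R)) -normrM.
  have -> : sinc x * x * pi = sin (pi * x) by rewrite -mul_sinc; ring.
  by rewrite ler_norml sin_geN1 sin_le1.
have := pi_ge2 R; have := normr_ge0 (sinc x * x).
by set a := `|_|; move: (pi : R) => p; nra.
Qed.

Definition sinsinc x : R := sin (pi * x) * sinc x.

Lemma continuous_sinsinc : continuous sinsinc.
Proof.
apply: continuous_mulr; last exact: continuous_sinc.
by move=> x; exact: is_derive_continuous (derive1_sin_scale pi x).
Qed.

Lemma sinsinc_bound x : `|sinsinc x * x| <= 2^-1.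
Proof.
rewrite /sinsinc -mulrA normrM (le_trans _ (sinc_bound x))//.
by rewrite ler_piMl// ler_norml sin_geN1 sin_le1.
Qed.

Lemma sinsincN x : sinsinc (- x) = - sinsinc x.
Proof. by rewrite /sinsinc sincN mulrN sinN mulNr. Qed.

Lemma cos_mul_sinc x : cos (pi * x) * sinc x = sinc (2 * x).
Proof.
have [->|x0] := eqVneq x 0; first by rewrite !mulr0 cos0 sinc0 mul1r.
rewrite !sincE// ?mulf_neq0//.
rewrite (_ : sin (pi * (2 * x)) = sin (pi * x + pi * x)); last first.
  by congr sin; ring.
rewrite sinD.
by move: (pi : R) pi_neq0 => c c0; field; rewrite c0 x0.
Qed.

(** Partial fractions in [t], after which each sine is expanded around the other shift. Every
    summand is then a shift of [sinsinc] or of [sinc (2 t)], whose primitives are at hand. *)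
Lemma sinc_mul_sinc (a b t : R) : a != b ->
  sinc (t - a) * sinc (t - b) = (pi * (a - b))^-1 *
    (cos (pi * (a - b)) * (sinsinc (t - a) - sinsinc (t - b)) +
     sin (pi * (a - b)) * (sinc (2 * (t - a)) + sinc (2 * (t - b)))).
Proof.
move=> ab; have ab0 : pi * (a - b) != 0 by rewrite mulf_neq0// subr_eq0.
apply: (mulfI ab0); rewrite mulVKf//.
rewrite -!cos_mul_sinc /sinsinc.
have -> : pi * (a - b) * (sinc (t - a) * sinc (t - b)) =
    (pi * (t - b) * sinc (t - b)) * sinc (t - a) -
    (pi * (t - a) * sinc (t - a)) * sinc (t - b) by ring.
rewrite !mul_sinc.
have e1 : sin (pi * (t - b)) = sin (pi * (t - a)) * cos (pi * (a - b)) +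
    cos (pi * (t - a)) * sin (pi * (a - b)).
  by rewrite -sinD; congr sin; ring.
have e2 : sin (pi * (t - a)) = sin (pi * (t - b)) * cos (pi * (a - b)) -
    cos (pi * (t - b)) * sin (pi * (a - b)).
  by rewrite -sinB; congr sin; ring.
by rewrite {1}e1 e2; ring.
Qed.


(** * Comparison of squared sinc with the Fejer kernel *)

Lemma mulr_cos_le_sin x : 0 <= x <= pi -> x * cos x <= sin x.
Proof.
move=> /andP[x0 xpi]; rewrite -subr_ge0.
have fd (y : R) : is_derive y 1 (fun y : R => sin y - y * cos y) (y * sin y).
  have := derive1_sub _ _ _ _ _ (is_derive_sin y)
    (derive1_mul _ _ _ _ _ (is_derive_id y 1) (is_derive_cos y)).
  by move=> h; apply: is_derive_eq; rewrite /=; ring.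
have [c /andP[c0 cx]] := MVT_derive _ _ _ _ fd x0.
rewrite sin0 mul0r !subr0 => ->; rewrite !mulr_ge0// sin_ge0_pi//.
by rewrite c0 (le_trans cx).
Qed.

(** Squaring [y cos y <= sin y] gives [y^2 - sin^2 y <= y^2 sin^2 y]. *)
Lemma inv_sqr_sin_bound y : 0 < y < pi / 2 ->
  0 <= (sin y ^+ 2)^-1 - (y ^+ 2)^-1 <= 1.
Proof.
move=> /andP[y0 y1].
have s0 : 0 < sin y by apply: sin_gt0_pihalf; rewrite y0.
have h1 : sin y <= y by apply: sin_le_id; exact: ltW.
have h2 : y * cos y <= sin y.
  by apply: mulr_cos_le_sin; have p0 := pi_gt0 R; apply/andP; split; lra.
have c0 : 0 < cos y by apply: cos_gt0_pihalf; apply/andP; split; lra.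
have := cos2Dsin2 y; move: (sin y) (cos y) s0 h1 h2 c0 => s c s0 h1 h2 c0 e.
have -> : (s ^+ 2)^-1 - (y ^+ 2)^-1 = (y ^+ 2 - s ^+ 2) / (y ^+ 2 * s ^+ 2).
  by field; rewrite !gt_eqF.
have d0 : 0 < y ^+ 2 * s ^+ 2 by rewrite mulr_gt0// exprn_gt0.
have h3 : (y * c) ^+ 2 <= s ^+ 2 by rewrite lerXn2r ?nnegrE ?mulr_ge0// ltW.
have h4 : s ^+ 2 <= y ^+ 2 by rewrite lerXn2r ?nnegrE// ltW.
apply/andP; split; first by rewrite divr_ge0 ?subr_ge0// ltW.
rewrite ler_pdivrMr// mul1r; move: h3; rewrite exprMn.
have -> : c ^+ 2 = 1 - s ^+ 2 by rewrite -e; ring.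
lra.
Qed.

(** Primitive, zero at 0, of the Dirichlet kernel of period 1. *)
Definition dirichlet_prim n x : R :=
  x + \sum_(k < n) (pi * k.+1%:R)^-1 * sin (pi * k.+1.*2%:R * x).

Definition dirichlet n x : R :=
  1 + \sum_(k < n) 2 * cos (pi * k.+1.*2%:R * x).

Definition fejer_prim n x : R := \sum_(j < n) dirichlet_prim j x.

(** The Fejer kernel without the factor [1 / n], that is [sin^2 (n pi x) / sin^2 (pi x)] where the
    denominator is nonzero. *)
Definition fejer n x : R := \sum_(j < n) dirichlet j x.

Lemma derive1_dirichlet n x : is_derive x 1 (dirichlet_prim n) (dirichlet n x).
Proof.
apply: derive1_add; apply: derive1_sum => k.
have := derive1_scale _ _ _ (pi * k.+1%:R)^-1
  (derive1_sin_scale (pi * k.+1.*2%:R) x).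
move=> h; apply: is_derive_eq.
have k0 : k.+1%:R != 0 :> R by rewrite pnatr_eq0.
rewrite -muln2 natrM mulrA; congr (_ * _).
by move: (pi : R) pi_neq0 => c c0; field; rewrite addrC natr1 c0 k0.
Qed.

Lemma derive1_fejer n x : is_derive x 1 (fejer_prim n) (fejer n x).
Proof. by apply: derive1_sum => j; exact: derive1_dirichlet. Qed.

Lemma sin_dirichlet n x :
  sin (pi * x) * dirichlet n x = sin (pi * x * n.*2.+1%:R).
Proof.
elim: n => [|n IH]; first by rewrite /dirichlet big_ord0 addr0 !mulr1.
rewrite /dirichlet big_ord_recr/= addrA mulrDr -/(dirichlet n x) IH.
have -> : pi * x * n.*2.+1%:R = pi * n.+1.*2%:R * x - pi * x.
  by rewrite doubleS -!natr1; ring.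
have -> : pi * x * n.+1.*2.+1%:R = pi * n.+1.*2%:R * x + pi * x.
  by rewrite -[n.+1.*2.+1%:R]natr1; ring.
by rewrite sinB sinD; ring.
Qed.

Lemma sin_fejer n x : sin (pi * x) ^+ 2 * fejer n x = sin (pi * x * n%:R) ^+ 2.
Proof.
elim: n => [|n IH]; first by rewrite /fejer big_ord0 !mulr0 sin0 expr0n.
rewrite /fejer big_ord_recr/= mulrDr -/(fejer n x) IH.
have -> : sin (pi * x) ^+ 2 * dirichlet n x =
    sin (pi * x) * (sin (pi * x) * dirichlet n x) by ring.
rewrite sin_dirichlet.
have -> : pi * x * n.*2.+1%:R = pi * x * n%:R + pi * x * n%:R + pi * x.
  by rewrite -natr1 -addnn natrD; ring.
have -> : pi * x * n.+1%:R = pi * x * n%:R + pi * x by rewrite -natr1; ring.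
move: (pi * x * n%:R) => B; move: (pi * x) => y.
have -> : sin (B + B + y) = 2 * sin B * cos B * cos y
    + (cos B ^+ 2 - sin B ^+ 2) * sin y.
  by rewrite (sinD (B + B)) sinD cosD; ring.
have -> : sin (B + y) ^+ 2 =
  sin B ^+ 2 * cos y ^+ 2 + 2 * sin B * cos B * sin y * cos y
    + cos B ^+ 2 * sin y ^+ 2 by rewrite sinD; ring.
have -> : cos y ^+ 2 = 1 - sin y ^+ 2 by rewrite -(cos2Dsin2 y); ring.
ring.
Qed.

Lemma fejer_prim0 n : fejer_prim n 0 = 0.
Proof.
rewrite /fejer_prim big1// => j _; rewrite /dirichlet_prim big1 ?addr0// => k _.
by rewrite mulr0 sin0 mulr0.
Qed.

Lemma sin_natpi k : sin (pi * k%:R) = 0 :> R.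
Proof.
elim: k => [|k IH]; first by rewrite mulr0 sin0.
by rewrite -natr1 mulrDr mulr1 sinDpi IH oppr0.
Qed.

Lemma fejer_prim_half n : fejer_prim n 2^-1 = n%:R / 2.
Proof.
rewrite /fejer_prim (eq_bigr (fun=> 2^-1)).
  by rewrite sumr_const card_ord mulrC mulr_natr.
move=> j _; rewrite /dirichlet_prim big1 ?addr0// => k _.
rewrite (_ : pi * k.+1.*2%:R / 2 = pi * k.+1%:R) ?sin_natpi ?mulr0//.
by rewrite -muln2 natrM mulrA mulfK.
Qed.

(** Both terms are [sin^2 (n pi x)] times an inverse square, of [pi x] and of [sin (pi x)], so the
    bound is uniform in [n]. *)
Lemma fejer_sinc_bound n x : 0 < x < 2^-1 ->
  `|n%:R ^+ 2 * sinc (n%:R * x) ^+ 2 - fejer n x| <= 1.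
Proof.
move=> /andP[x0 x1]; have pi0 := pi_gt0 R.
have /andP[h1 h2] : 0 <= (sin (pi * x) ^+ 2)^-1 - ((pi * x) ^+ 2)^-1 <= 1.
  apply: inv_sqr_sin_bound; rewrite mulr_gt0//= ltr_pM2l//.
have s0 : sin (pi * x) != 0.
  rewrite gt_eqF// sin_gt0_pihalf// mulr_gt0//= ltr_pM2l//.
have -> : fejer n x = sin (pi * x * n%:R) ^+ 2 * (sin (pi * x) ^+ 2)^-1.
  by rewrite -sin_fejer mulrC mulKf// expf_neq0.
have -> : n%:R ^+ 2 * sinc (n%:R * x) ^+ 2 =
    sin (pi * x * n%:R) ^+ 2 * ((pi * x) ^+ 2)^-1.
  have -> : sin (pi * x * n%:R) = pi * (n%:R * x) * sinc (n%:R * x).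
    by rewrite mul_sinc; congr sin; ring.
  have xn0 : x != 0 by rewrite gt_eqF.
  by move: (pi : R) pi_neq0 => c c0; field; rewrite c0 xn0.
rewrite -mulrBr normrM -[X in _ <= X]mulr1 ler_pM//.
  by rewrite ger0_norm ?sqr_ge0.
by rewrite distrC ger0_norm.
Qed.

(** * The primitive of sinc and its limit at infinity *)

Section SincPrimitive.
Variable W : R -> R.
Hypothesis W0 : W 0 = 0.
Hypothesis dW : forall x : R, is_derive x 1 W (sinc x).

Definition sinc_sqr_prim x : R := W (2 * x) - x * sinc x ^+ 2.

(** Away from 0, [(x sinc^2 x)' = 2 cos (pi x) sinc x - sinc^2 x = 2 sinc (2 x) - sinc^2 x]. *)
Lemma derive1_sinc_sqr_prim x : is_derive x 1 sinc_sqr_prim (sinc x ^+ 2).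
Proof.
have h1 : is_derive x 1 (fun t => W (2 * t)) (2 * sinc (2 * x)).
  have := @derive1_affine R W x _ 2 0 (dW _).
  by rewrite addr0; under eq_fun do rewrite addr0.
have [x0|x0] := eqVneq x 0.
  have c2 : continuous (fun t : R => sinc t ^+ 2).
    under eq_fun do rewrite expr2.
    by apply: continuous_mulr; exact: continuous_sinc.
  move: h1; rewrite x0 => h1.
  have := derive1_sub _ _ _ _ _ h1 (derive1_mulid _ (c2 0)).
  rewrite mulr0 sinc0 => h; apply: is_derive_eq.
  by rewrite expr1n; ring.
have h2 := derive1_sinc x x0.
have h3 := derive1_mul _ _ _ _ _ (is_derive_id x 1) (derive1_mul _ _ _ _ _ h2 h2).
have := derive1_sub _ _ _ _ _ h1 h3; rewrite -cos_mul_sinc => h.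
have {}h : is_derive x 1 (fun t => W (2 * t) - t * (sinc t * sinc t)) (sinc x ^+ 2).
  by apply: is_derive_eq; rewrite /=; field.
by rewrite /sinc_sqr_prim; under eq_fun do rewrite expr2.
Qed.

(* The mean value theorem on [0, 1/2] compares the integral of
   [n^2 sinc^2 (n x)] with the one of the Fejer kernel, which is [n / 2]. *)
Lemma sinc_prim_nat n : (0 < n)%N -> `|W n%:R - 2^-1| <= n%:R^-1.
Proof.
move=> n0; have n0R : 0 < n%:R :> R by rewrite ltr0n.
pose Psi x := n%:R * sinc_sqr_prim (n%:R * x) - fejer_prim n x.
have dPsi x : is_derive x 1 Psi
    (n%:R ^+ 2 * sinc (n%:R * x) ^+ 2 - fejer n x).
  have := @derive1_affine R sinc_sqr_prim x _ n%:R 0 (derive1_sinc_sqr_prim _).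
  rewrite addr0 => h.
  have := derive1_sub _ _ _ _ _ (derive1_scale _ _ _ n%:R h) (derive1_fejer n x).
  by rewrite /Psi mulrA -expr2; under eq_fun do rewrite addr0.
have half0 : 0 < 2^-1 :> R by rewrite invr_gt0.
have cPsi : {within `[0, 2^-1], continuous Psi}.
  by apply: continuous_subspaceT => y; exact: is_derive_continuous (dPsi y).
have [c cin] := MVT half0 (fun x _ => dPsi x) cPsi.
rewrite {1 2}/Psi fejer_prim0 fejer_prim_half mulr0 {2}/sinc_sqr_prim.
rewrite mulr0 W0 mul0r !subr0 mulr0 !subr0.
move: cin; rewrite in_itv/= => /(fejer_sinc_bound n).
set B := _ - fejer n c => hB e.
have : `|n%:R * sinc_sqr_prim (n%:R / 2) - n%:R / 2| <= 2^-1.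
  by rewrite e normrM (ger0_norm (ltW half0)) ler_piMl.
rewrite /sinc_sqr_prim (_ : 2 * (n%:R / 2) = n%:R); last by field.
(* With [z = sinc (n / 2)] this yields [n^2 z^2 <= 1], so the term [n^2 z^2 / 2] adds at most [1/2]
   to the [1/2] from the mean value theorem. *)
have hs := sinc_bound (n%:R / 2).
have {hs} : (sinc (n%:R / 2) * (n%:R / 2)) ^+ 2 <= 2^-1 ^+ 2 :> R.
  by rewrite -real_normK ?num_real// lerXn2r ?nnegrE ?invr_ge0.
have := sqr_ge0 (sinc (n%:R / 2) * (n%:R / 2) : R).
set z := sinc _; set w := W _ => hz0 hz h.
have -> : n%:R^-1 = n%:R^-1 * 1 :> R by rewrite mulr1.
rewrite -(ler_pM2l n0R) mulVKf ?gt_eqF// -{1}(gtr0_norm n0R) -normrM.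
move: h; rewrite !ler_norml; move: hz hz0; rewrite exprMn.
move: (n%:R : R) n0R => m m0.
have -> : (m / 2) ^+ 2 = m ^+ 2 / 4 by field.
have -> : m * (w - m / 2 * z ^+ 2) - m / 2 =
    m * (w - 2^-1) - m ^+ 2 * z ^+ 2 / 2 by field.
have -> : 2^-1 ^+ 2 = 4^-1 :> R by field.
move: (m * (w - 2^-1)) => u; rewrite (mulrC (z ^+ 2)).
have -> : m ^+ 2 / 4 * z ^+ 2 = m ^+ 2 * z ^+ 2 / 4 by ring.
by move: (m ^+ 2 * z ^+ 2) => v h1 h2 /andP[h3 h4]; apply/andP; split; lra.
Qed.

(** From the integer part [n] of [x] up to [x], [W] varies by at most [1 / n], since
    [|sinc c| <= 1 / n] for [c >= n]. *)
Lemma sinc_prim_bound x : 1 < x -> `|W x - 2^-1| <= 2 / (x - 1).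
Proof.
move=> x1; pose n := Num.truncn x.
have /andP[nx xn] : n%:R <= x < n.+1%:R by apply: truncn_itv; lra.
have n0 : (0 < n)%N by rewrite truncn_gt0 ltW.
have n0R : 0 < n%:R :> R by rewrite ltr0n.
have [c /andP[nc cx] e] := MVT_derive _ _ _ _ dW nx.
have h1 := sinc_prim_nat n n0.
have h2 : `|W x - W n%:R| <= n%:R^-1.
  rewrite e normrM (ger0_norm (_ : 0 <= x - n%:R)) ?subr_ge0//.
  have c0 : 0 < c by exact: lt_le_trans n0R nc.
  have hc : `|sinc c| <= n%:R^-1.
    have := sinc_bound c; rewrite normrM (gtr0_norm c0) -ler_pdivlMr// => hc.
    apply: (le_trans hc); apply: (@le_trans _ _ c^-1).
      by rewrite ler_piMl ?invr_ge0 ?(ltW c0)//; lra.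
    by rewrite lef_pV2 ?posrE.
  rewrite -[X in _ <= X]mulr1; apply: ler_pM => //.
    by rewrite subr_ge0.
  by move: xn; rewrite -natr1; lra.
have -> : W x - 2^-1 = (W x - W n%:R) + (W n%:R - 2^-1) by ring.
apply: (le_trans (ler_normD _ _)); apply: (@le_trans _ _ (2 / n%:R)).
  by apply: le_trans (lerD h2 h1) _; lra.
rewrite ler_pM2l// lef_pV2 ?posrE ?subr_gt0//.
by move: xn; rewrite -natr1; lra.
Qed.

Lemma sinc_primN x : W (- x) = - W x.
Proof.
have d0 (y : R) : is_derive y 1 (fun t => W (-1 * t + 0) + W t) 0.
  have := derive1_add _ _ _ _ _ (derive1_affine _ y _ (-1) 0 (dW _)) (dW y).
  by rewrite addr0 !mulN1r sincN => h; apply: is_derive_eq; ring.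
have := @is_derive_0_is_cst _ _ x 0 d0.
rewrite mulr0 !addr0 mulN1r W0 addr0 => /eqP; rewrite addr_eq0 => /eqP //.
Qed.

End SincPrimitive.

End Sinc.

(** * The energy as a Gram form *)

Section Energy.
Context {R : realType}.

Lemma derive1_shift (f : R -> R) (x a d : R) : is_derive (x - a) 1 f d ->
  is_derive x 1 (fun t => f (t - a)) d.
Proof.
move=> h; have := @derive1_affine R f x d 1 (- a).
by rewrite !mul1r => /(_ h); under eq_fun do rewrite mul1r.
Qed.

(** As [G] is nonnegative, its integral over [[-t, t]], which is [P t - P (- t)], stays below the
    full integral. *)
Lemma le_integral_of_primitive (G P : R -> R) (L : R) :
  continuous G -> (forall t, 0 <= G t) ->
  (forall t : R, is_derive t 1 P (G t)) ->
  P t - P (- t) @[t --> +oo] --> L ->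
  (L%:E <= \int[@lebesgue_measure R]_(t in [set: R]) (G t)%:E)%E.
Proof.
move=> cG G0 dP cvgP.
set E := (\int[_]_(t in _) _)%E.
have PE t : 0 < t -> ((P t - P (- t))%:E <= E)%E.
  move=> t0.
  rewrite EFinB -(@continuous_FTC2 R G P (- t) t).
  - apply: ge0_subset_integral => //=.
    + apply/measurable_EFinP; exact: continuous_measurable_fun.
    + by move=> y _; rewrite lee_fin.
  - lra.
  - exact: continuous_subspaceT.
  - have cP := is_derive_continuous _ _ _ (dP _).
    split; first by move=> y _; exact: (@ex_derive _ _ _ _ _ _ _ (dP y)).
      by apply: cvg_at_right_filter; exact: cP.
    by apply: cvg_at_left_filter; exact: cP.
  - by move=> y _; rewrite derive1E; apply: (@derive_val _ _ _ _ _ _ _ (dP y)).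
have : (0 <= E)%E by apply: integral_ge0 => t _; rewrite lee_fin.
case: E PE => [e|_ _|//]; last by rewrite leey.
move=> PE _; rewrite lee_fin -(cvg_lim _ cvgP)//.
apply: limr_le; first by apply/cvg_ex; exists L.
near=> t; rewrite -lee_fin; apply: PE.
by near: t; apply: nbhs_pinfty_gt; rewrite num_real.
Unshelve. all: by end_near. Qed.

Variables W U : R -> R.
Hypothesis W0 : W 0 = 0.
Hypothesis dW : forall x : R, is_derive x 1 W (sinc x).
Hypothesis dU : forall x : R, is_derive x 1 U (sinsinc x).

Lemma sinsinc_primN x : U (- x) = U x.
Proof.
have d0 (y : R) : is_derive y 1 (fun t => U (-1 * t + 0) - U t) 0.
  have := derive1_sub _ _ _ _ _ (derive1_affine _ y _ (-1) 0 (dU _)) (dU y).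
  by rewrite addr0 !mulN1r sinsincN => h; apply: is_derive_eq; ring.
have := @is_derive_0_is_cst _ _ x 0 d0.
by rewrite mulr0 !addr0 mulN1r subrr => /eqP; rewrite subr_eq0 => /eqP.
Qed.

Lemma sinsinc_prim_lip (m s s' : R) : 0 < m -> m <= s -> m <= s' ->
  `|U s - U s'| <= `|s - s'| / m.
Proof.
move=> m0; wlog ss : s s' / s' <= s => [H ms ms'|ms ms'].
  by have [/H|/ltW/H] := leP s' s; [exact|rewrite distrC [`|s - _|]distrC; exact].
have [c /andP[c1 c2] ->] := MVT_derive _ _ _ _ dU ss.
rewrite normrM mulrC ler_wpM2l//.
have c0 : 0 < c by lra.
have := sinsinc_bound c; rewrite normrM (gtr0_norm c0) -ler_pdivlMr// => hc.
apply: (le_trans hc); apply: (@le_trans _ _ c^-1).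
  by rewrite ler_piMl ?invr_ge0 ?(ltW c0)//; lra.
by rewrite lef_pV2 ?posrE//; lra.
Qed.

(** [U] itself grows logarithmically, but [sinsinc] decays like [1 / s], so increments over a
    bounded distance vanish at infinity. *)
Lemma cvgy_sinsinc_prim (a b : R) : U (t - a) - U (t - b) @[t --> +oo] --> 0.
Proof.
apply: (@cvgy_bound _ _ _ (`|a| + `|b|) `|a - b|) => t ht.
have ha := ler_norm a; have hb := ler_norm b.
have na := normr_ge0 a; have nb := normr_ge0 b.
rewrite subr0 (le_trans (sinsinc_prim_lip (t - (`|a| + `|b|)) _ _ _ _ _))//; try lra.
have -> : t - a - (t - b) = - (a - b) by ring.
by rewrite normrN.
Qed.

Lemma cvgy_sinc_prim (a : R) : W (2 * (t - a)) @[t --> +oo] --> (2^-1 : R).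
Proof.
apply: (@cvgy_bound _ _ _ (a + 2^-1) 1) => t ht.
have h : 1 < 2 * (t - a) by lra.
apply: (le_trans (sinc_prim_bound _ W0 dW _ h)).
have -> : 2 * (t - a) - 1 = 2 * (t - (a + 2^-1)) by field.
by rewrite invfM mulrA divff// mul1r.
Qed.

Lemma cvgy_sinc_sqr_prim (a : R) :
  sinc_sqr_prim W (t - a) @[t --> +oo] --> (2^-1 : R).
Proof.
rewrite -[X in _ --> X]subr0; apply: (@cvgB _ R^o); first exact: cvgy_sinc_prim.
apply: (@cvgy_bound _ _ _ a 1) => t ht; rewrite subr0.
have s0 : 0 < t - a by lra.
rewrite ler_pdivlMr// -[X in _ * X <= _](gtr0_norm s0) -normrM.
have -> : (t - a) * sinc (t - a) ^+ 2 * (t - a) = (sinc (t - a) * (t - a)) ^+ 2.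
  by ring.
rewrite normrX; have := sinc_bound (t - a); have := normr_ge0 (sinc (t - a) * (t - a)).
by set z := `|_|; nra.
Qed.

(** Termwise primitive of [sinc_mul_sinc]; its factor [(a - b)^-1] forces a separate diagonal
    case. *)
Definition sinc_mul_prim (a b t : R) : R :=
  if a == b then sinc_sqr_prim W (t - a) else
  (pi * (a - b))^-1 *
    (cos (pi * (a - b)) * (U (t - a) - U (t - b)) +
     sin (pi * (a - b)) * (2^-1 * W (2 * (t - a)) + 2^-1 * W (2 * (t - b)))).

Lemma derive1_sinc_mul_prim (a b t : R) :
  is_derive t 1 (sinc_mul_prim a b) (sinc (t - a) * sinc (t - b)).
Proof.
rewrite /sinc_mul_prim; have [<-|ab] := eqVneq a b.
  rewrite -expr2; apply: derive1_shift; exact: derive1_sinc_sqr_prim.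
rewrite sinc_mul_sinc//.
have dW2 c : is_derive t 1 (fun t => 2^-1 * W (2 * (t - c))) (sinc (2 * (t - c))).
  have h : is_derive (t - c) 1 (fun s => W (2 * s)) (2 * sinc (2 * (t - c))).
    have := @derive1_affine R W (t - c) _ 2 0 (dW _).
    by rewrite addr0; under eq_fun do rewrite addr0.
  have := derive1_scale _ _ _ 2^-1 (derive1_shift _ _ _ _ h).
  by rewrite mulKf.
apply: derive1_scale; apply: derive1_add; apply: derive1_scale.
  by apply: derive1_sub; exact: derive1_shift.
Qed.

(** [U] is even and [W] is odd: the differences of [U] vanish in the limit, while the four [W] terms
    give [1/4] each and add up. *)
Lemma cvgy_sinc_mul_prim (a b : R) :
  sinc_mul_prim a b t - sinc_mul_prim a b (- t) @[t --> +oo] --> sinc (a - b).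
Proof.
rewrite /sinc_mul_prim; have [<-|ab] := eqVneq a b.
  have e t : sinc_sqr_prim W (- t - a) = - sinc_sqr_prim W (t - - a).
    rewrite /sinc_sqr_prim (_ : - t - a = - (t - - a)); last by ring.
    by rewrite mulrN (sinc_primN _ W0 dW) sincN; ring.
  under eq_fun do rewrite e opprK.
  rewrite subrr sinc0 (_ : 1 = 2^-1 + 2^-1); last by field.
  by apply: (@cvgD _ R^o); exact: cvgy_sinc_sqr_prim.
have eU t c : U (- t - c) = U (t - - c).
  by rewrite -sinsinc_primN; congr U; ring.
have eW t c : W (2 * (- t - c)) = - W (2 * (t - - c)).
  by rewrite -(sinc_primN _ W0 dW); congr W; ring.
under eq_fun do rewrite !eU !eW -mulrBr.
rewrite sincE ?subr_eq0// mulrC.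
have cM (c : R) (f : R -> R) (l : R) :
    f t @[t --> +oo] --> l -> c * f t @[t --> +oo] --> c * l.
  by move=> fl; apply: cvgM => //; exact: cvg_cst.
apply: (cM _ _ _).
set C := cos _; set S := sin _.
rewrite [X in _ --> X](_ : S = (C * 0 + S * (2^-1 * 2^-1 + 2^-1 * 2^-1)) -
   (C * 0 + S * (2^-1 * - 2^-1 + 2^-1 * - 2^-1))); last by field.
apply: (@cvgB _ R^o); apply: (@cvgD _ R^o); apply: (cM _ _ _).
- exact: cvgy_sinsinc_prim.
- by apply: (@cvgD _ R^o); apply: (cM _ _ _); exact: cvgy_sinc_prim.
- exact: cvgy_sinsinc_prim.
- by apply: (@cvgD _ R^o); apply: (cM _ _ _); apply: (@cvgN _ R^o);
    exact: cvgy_sinc_prim.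
Qed.

End Energy.

(** * Finite combinations of sincs and complex coefficients *)

Section Gram.
Context {R : realType} {N : nat} (lam : 'I_N -> R).

Lemma cvgy_sumr (I : Type) (r : seq I) (F : I -> R -> R) (l : I -> R) :
  (forall i, F i t @[t --> +oo] --> l i) ->
  \sum_(i <- r) F i t @[t --> +oo] --> \sum_(i <- r) l i.
Proof.
move=> Fl; elim: r => [|i r IH].
  by rewrite big_nil; under eq_fun do rewrite big_nil; exact: cvg_cst.
rewrite big_cons; under eq_fun do rewrite big_cons.
by apply: (@cvgD _ R^o); [exact: Fl|exact: IH].
Qed.

Lemma sinc_comb_sqr_primitive (x : 'I_N -> R) :
  exists P : R -> R,
    (forall t : R, is_derive t 1 P ((\sum_i x i * sinc (t - lam i)) ^+ 2)) /\
    P t - P (- t) @[t --> +oo] -->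
      (\sum_i \sum_j x i * x j * sinc (lam i - lam j) : R).
Proof.
have [W1 dW1] := primitive_exists _ (@continuous_sinc R).
have [U dU] := primitive_exists _ (@continuous_sinsinc R).
(* Normalised to vanish at 0, so that [W] is odd and tends to [1/2]. *)
pose W t := W1 t - W1 0.
have W0 : W 0 = 0 by rewrite /W subrr.
have dW (t : R) : is_derive t 1 W (sinc t).
  have := derive1_sub _ _ _ _ _ (dW1 t) (is_derive_cst (W1 0) t 1).
  by rewrite subr0.
exists (fun t => \sum_i \sum_j x i * x j * sinc_mul_prim W U (lam i) (lam j) t).
split=> [t|].
  have -> : (\sum_i x i * sinc (t - lam i)) ^+ 2 =
      \sum_i \sum_j x i * x j * (sinc (t - lam i) * sinc (t - lam j)).
    rewrite expr2 mulr_suml; apply: eq_bigr => i _.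
    by rewrite mulr_sumr; apply: eq_bigr => j _; ring.
  apply: derive1_sum => i; apply: derive1_sum => j; apply: derive1_scale.
  exact: derive1_sinc_mul_prim.
under eq_fun do (rewrite -sumrB; under eq_bigr do rewrite -sumrB).
apply: cvgy_sumr => i; apply: cvgy_sumr => j.
under eq_fun do rewrite -mulrBr.
by apply: cvgM; [exact: cvg_cst|exact: cvgy_sinc_mul_prim].
Qed.

Lemma continuous_sinc_comb (x : 'I_N -> R) :
  continuous (fun t => \sum_i x i * sinc (t - lam i)).
Proof.
apply: continuous_sumr => i; apply: continuous_mulr; first exact: cst_continuous.
move=> t; apply: (@continuous_comp _ _ _ (fun t => t - lam i));
  last exact: continuous_sinc.
by apply: (@cvgB _ R^o); [exact: cvg_id|exact: cvg_cst].
Qed.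

Lemma cmod_sqr (z : R[i]) : cmod z ^+ 2 = complex.Re z ^+ 2 + complex.Im z ^+ 2.
Proof. by case: z => u v; rewrite /cmod normc_def/= sqr_sqrtr// addr_ge0// sqr_ge0. Qed.

Lemma cmod_sinc_sum_sqr (a : 'I_N -> R[i]) t :
  cmod (sinc_sum a lam t) ^+ 2 =
  (\sum_i complex.Re (a i) * sinc (t - lam i)) ^+ 2 +
  (\sum_i complex.Im (a i) * sinc (t - lam i)) ^+ 2.
Proof.
rewrite cmod_sqr /sinc_sum !raddf_sum; congr (_ ^+ 2 + _ ^+ 2);
  apply: eq_bigr => i _; case: (a i) => u v /=; ring.
Qed.

End Gram.

Theorem theorem1 (R : realType) (N : nat) (a : 'I_N -> R[i]) (lam : 'I_N -> R)
  (gamma : R)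
  (hgamma : Num.sqrt (3^-1 + pi ^+ 2 / 12) < gamma)
  (hsep : forall n m : 'I_N, n != m -> gamma <= `|lam n - lam m|) :
  (((1 - gamma^-1 * Num.sqrt (3^-1 + pi ^+ 2 / 12)) *
      \sum_(n < N) cmod (a n) ^+ 2)%:E <= energy (sinc_sum a lam))%E.
Proof.
have g0 : 0 < gamma by apply: le_lt_trans hgamma; exact: sqrtr_ge0.
pose x i := complex.Re (a i); pose y i := complex.Im (a i).
have [P [dP cP]] := sinc_comb_sqr_primitive lam x.
have [Q [dQ cQ]] := sinc_comb_sqr_primitive lam y.
rewrite /energy; under eq_integral do rewrite cmod_sinc_sum_sqr.
(* [P + Q] is a primitive of [|f|^2], and its increments over [[-t, t]] tend to the sum of the Gram
   forms of the real and imaginary parts. *)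
apply: le_trans (le_integral_of_primitive _ (fun t => P t + Q t) _ _ _ _ _).
- rewrite lee_fin; apply: le_trans (lerD (sinc_gram_ge lam gamma g0 hsep x)
    (sinc_gram_ge lam gamma g0 hsep y)).
  rewrite -mulrDr -big_split/=; under eq_bigr do rewrite cmod_sqr.
  by [].
- have c2 (z : 'I_N -> R) :
      continuous (fun t => (\sum_i z i * sinc (t - lam i)) ^+ 2).
    under eq_fun do rewrite expr2.
    by apply: continuous_mulr; exact: continuous_sinc_comb.
  by move=> t; apply: (@cvgD _ R^o); exact: c2.
- by move=> t; rewrite addr_ge0// sqr_ge0.
- under eq_fun do rewrite opprD addrACA.
  by apply: (@cvgD _ R^o); [exact: cP|exact: cQ].
Qed.
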